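(* Let $R$ be an integral domain and let $M$ be a nonzero, non-simple factorial $R$-module with $\operatorname{Irr}(M)\cap u(M)=\emptyset$. Then the divisor topology $D(M)$ is a Baire space.
   Context: For $m,n\in M$ write $m\mid n$ if $n=rm$ for some $r\in R$ (equivalently $Rn\subseteq Rm$). Put $M^{\#}=\{0\neq m\in M: Rm\neq M\}$ and define an equivalence relation on $M^{\#}$ by $m\sim n$ iff $Rm=Rn$; let $[m]$ be the class of $m$ and $\operatorname{EC}(M^{\#})=\{[m]:m\in M^{\#}\}$. For $m\in M^{\#}$ let $U_m=\{[n]\in \operatorname{EC}(M^{\#}): n\mid m\}$. The family $\{U_m\}_{m\in M^{\#}}$ is a basis of a topology on $\operatorname{EC}(M^{\#})$, called the divisor topology of $M$ and denoted $D(M)$ (also denoting the resulting space). An element $m\in M$ is irreducible (in $M$) if whenever $m_1\mid m$ with $m_1\in M$, then $m\mid m_1$. $\operatorname{Irr}(M)$ is the set of irreducible elements of $M$, and $u(M)=\{m\in M: Rm=M\}$ is the set of generators of $M$. $M$ is torsion free if $rm=0$ with $r\in R$, $m\in M$ implies $r=0$ or $m=0$. A torsion free $R$-module $M$ is factorial if: (i) every nonzero $m\in M$ has an irreducible factorization $m=q_1q_2\cdots q_n m'$ with $n\ge 0$, $q_1,\dots,q_n$ irreducible elements of $R$ and $m'$ an irreducible element of $M$; and (ii) if $m=q_1\cdots q_n m'=p_1\cdots p_t m''$ are two such irreducible factorizations, then $n=t$, the $q_i$ and $p_j$ agree up to order and associates in $R$, and $m'\sim m''$, i.e. $Rm'=Rm''$.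 A topological space is a Baire space if the intersection of every countable family of open dense subsets is dense. *)

(* Defs.v *)
From HB Require Import structures.
From mathcomp Require Import all_boot all_order all_algebra.
From mathcomp Require Import perm.
From mathcomp Require Import boolp classical_sets functions cardinality.
From mathcomp Require Import topology.

Set Implicit Arguments.
Unset Strict Implicit.
Unset Printing Implicit Defensive.

Import GRing.Theory.
Local Open Scope classical_set_scope.
Local Open Scope quotient_scope.
Local Open Scope ring_scope.

Section Ring.
Variable R : idomainType.

(* The usual notion for ring elements (nonzero nonunit atoms); it is not
   [irreducibles] below taken at M = R, which would give the units of R. *)
Definition irreducible_ring (q : R) : Prop :=
  [/\ q != 0, q \isn't a GRing.unit &
      forall a b : R, q = a * b ->
        a \is a GRing.unit \/ b \is a GRing.unit].

Definition associates (p q : R) : Prop :=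
  exists2 u : R, u \is a GRing.unit & q = u * p.

Definition agree_up_to_associates (qs ps : seq R) : Prop :=
  size qs = size ps /\
  exists s : {perm 'I_(size qs)},
    forall i : 'I_(size qs), associates qs`_i ps`_(s i).

End Ring.

Section Module.
Variables (R : idomainType) (M : lmodType R).
Implicit Types m n : M.

Definition mdivides m n : Prop := exists r : R, n = r *: m.

Definition cyclic_submodule m : set M := [set r *: m | r in [set: R]].

Definition generators : set M := [set m | cyclic_submodule m = [set: M]].

Definition irreducibles : set M :=
  [set m | forall m1 : M, mdivides m1 m -> mdivides m m1].

Definition simple_module : Prop :=
  (exists m : M, m != 0) /\
  forall N : {pred M}, submod_closed N -> N =i pred1 0 \/ N =i predT.

Definition torsion_free : Prop :=
  forall (r : R) (m : M), r *: m = 0 -> r = 0 \/ m = 0.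

(* [qs] may be empty: the factorizations have n >= 0 ring factors. *)
Definition irreducible_factorization m (qs : seq R) (m' : M) : Prop :=
  [/\ forall q : R, q \in qs -> irreducible_ring q,
      irreducibles m' &
      m = (\prod_(q <- qs) q) *: m'].

Definition factorial_module : Prop :=
  torsion_free /\
  forall m : M, m != 0 ->
    (exists (qs : seq R) (m' : M), irreducible_factorization m qs m') /\
    (forall (qs ps : seq R) (m' m'' : M),
       irreducible_factorization m qs m' ->
       irreducible_factorization m ps m'' ->
       agree_up_to_associates qs ps /\
       cyclic_submodule m' = cyclic_submodule m'').

Definition msharp : set M :=
  [set m | m != 0 /\ cyclic_submodule m <> [set: M]].

Definition msim (m n : msharp) : bool :=
  `[< cyclic_submodule (val m) = cyclic_submodule (val n) >].

Lemma msim_refl : reflexive msim.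
Proof. by move=> m; apply/asboolP. Qed.

Lemma msim_sym : symmetric msim.
Proof. by move=> m n; apply/asboolP/asboolP. Qed.

Lemma msim_trans : transitive msim.
Proof.
by move=> n m p /asboolP mn /asboolP np; apply/asboolP; rewrite mn.
Qed.

Canonical msim_equiv := EquivRel msim msim_refl msim_sym msim_trans.

(* EC(M^#) as a quotient of M^#, equipped below with the topology D(M). *)
Definition divisor_space : Type := {eq_quot msim}.
HB.instance Definition _ := Choice.on divisor_space.
HB.instance Definition _ := EqQuotient.on divisor_space.

Definition divisor_class (m : msharp) : divisor_space := \pi_divisor_space m.

Lemma divisor_classP (m n : msharp) :
  divisor_class m = divisor_class n <->
  cyclic_submodule (val m) = cyclic_submodule (val n).
Proof.
rewrite /divisor_class; split; first by move=> /eqmodP /asboolP.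
by move=> mn; apply/eqmodP/asboolP.
Qed.

Definition divisor_basic (m : msharp) : set divisor_space :=
  [set divisor_class n | n in [set n : msharp | mdivides (val n) (val m)]].

Lemma mdivides_refl m : mdivides m m.
Proof. by exists 1; rewrite scale1r. Qed.

Lemma mdivides_trans n m p : mdivides m n -> mdivides n p -> mdivides m p.
Proof. by move=> [r ->] [s ->]; exists (s * r); rewrite scalerA. Qed.

Lemma cyclic_mdivides m n :
  cyclic_submodule m = cyclic_submodule n -> mdivides m n.
Proof.
move=> mn; have : cyclic_submodule m n.
  by rewrite mn; exists 1 => //; rewrite scale1r.
by case=> r _ <-; exists r.
Qed.

Lemma divisor_basicP (m n : msharp) :
  divisor_basic m (divisor_class n) <-> mdivides (val n) (val m).
Proof.
split; last by move=> nm; exists n.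
case=> p /= pm /divisor_classP/esym/cyclic_mdivides np.
exact: mdivides_trans np pm.
Qed.

Lemma divisor_classE (x : divisor_space) : exists m : msharp, x = divisor_class m.
Proof. by exists (generic_quotient.repr x); rewrite /divisor_class reprK. Qed.

(* The base is the family of all U_m, indexed by itself. *)
Let base_cover : \bigcup_(U in range divisor_basic) id U = setT.
Proof.
apply/seteqP; split=> // x _; have [m ->] := divisor_classE x.
by exists (divisor_basic m); [exists m | apply/divisor_basicP/mdivides_refl].
Qed.

Let base_join (U V : set divisor_space) (x : divisor_space) :
  range divisor_basic U -> range divisor_basic V -> id U x -> id V x ->
  exists W, [/\ range divisor_basic W, id W x & id W `<=` id U `&` id V].
Proof.
move=> [m _ <-] [n _ <-]; have [p ->] := divisor_classE x.
move=> /divisor_basicP pm /divisor_basicP pn.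
exists (divisor_basic p); split; first by exists p.
  exact/divisor_basicP/mdivides_refl.
move=> y; have [q ->] := divisor_classE y => /divisor_basicP qp.
by split; apply/divisor_basicP; apply: mdivides_trans qp _.
Qed.

HB.instance Definition _ :=
  isBaseTopological.Build divisor_space base_cover base_join.

Lemma open_divisorP (A : set divisor_space) :
  open A <-> exists D : set msharp, A = \bigcup_(m in D) divisor_basic m.
Proof.
split.
  move=> [D DB <-]; exists [set m | D (divisor_basic m)].
  apply/seteqP; split=> x.
    by move=> [U DU Ux]; have [m _ mU] := DB _ DU; exists m => //=; rewrite mU.
  by move=> [m Dm mx]; exists (divisor_basic m).
move=> [D ->]; exists (divisor_basic @` D); last by rewrite bigcup_image.
by move=> _ [m _ <-]; exists m.
Qed.

End Module.

Arguments generators {R} M.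
Arguments irreducibles {R} M.
Arguments msharp {R} M.

Definition baire_space (T : topologicalType) : Prop :=
  forall F : set (set T), countable F ->
    (forall A : set T, F A -> open A /\ dense A) ->
    dense (\bigcap_(A in F) A).

(* Main.v *)
Require Import Defs.
From HB Require Import structures.
From mathcomp Require Import all_boot all_order all_algebra.
From mathcomp Require Import perm.
From mathcomp Require Import boolp classical_sets functions cardinality.
From mathcomp Require Import topology.

Import GRing.Theory.
Local Open Scope classical_set_scope.
Local Open Scope ring_scope.

(* An irreducible element has no divisor but its own associates, so its class
   is an isolated point of D(M), and every dense set contains it. As every
   nonzero element has an irreducible divisor, which is not a generator, the
   isolated points are dense. *)

Lemma mdivides_cyclic (R : idomainType) (M : lmodType R) (m n : M) :
  mdivides m n -> cyclic_submodule n `<=` cyclic_submodule m.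
Proof. by move=> [r ->] _ [s _ <-]; exists (s * r); rewrite ?scalerA. Qed.

Lemma divisor_basic_open (R : idomainType) (M : lmodType R) (m : msharp M) :
  open (divisor_basic m).
Proof. by apply/open_divisorP; exists [set m]; rewrite bigcup_set1. Qed.

(** An open set is a union of sets [divisor_basic p], and each of these is closed under divisors by
    transitivity. *)
Lemma open_divisor_closed (R : idomainType) (M : lmodType R)
    (O : set (divisor_space M)) (m n : msharp M) :
  open O -> O (divisor_class m) -> mdivides (val n) (val m) ->
  O (divisor_class n).
Proof.
move=> /open_divisorP[D ->] [p Dp /divisor_basicP mp] nm.
by exists p => //; apply/divisor_basicP; apply: mdivides_trans nm mp.
Qed.

Lemma divisor_basic_irreducible (R : idomainType) (M : lmodType R)
    (m : msharp M) :
  irreducibles M (val m) -> divisor_basic m = [set divisor_class m].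
Proof.
move=> m_irr; apply/seteqP; split=> [_ [n /= nm <-]|_ ->]; last first.
  exact/divisor_basicP/mdivides_refl.
(* The inclusion left open needs [m] to divide [n], which irreducibility of [m] yields from [nm]. *)
apply/divisor_classP/seteqP; split; apply: mdivides_cyclic => //.
exact: m_irr.
Qed.

(** [A] meets the nonempty open set [divisor_basic m], which is a singleton. *)
Lemma dense_irreducible (R : idomainType) (M : lmodType R)
    (A : set (divisor_space M)) (m : msharp M) :
  dense A -> irreducibles M (val m) -> A (divisor_class m).
Proof.
move=> A_dense m_irr.
have [|x []] := A_dense (divisor_basic m) _ (divisor_basic_open _ _ m).
  by exists (divisor_class m); apply/divisor_basicP/mdivides_refl.
by rewrite divisor_basic_irreducible // => ->.
Qed.

Lemma factorial_irreducible_divisor (R : idomainType) (M : lmodType R)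
    (m : msharp M) :
  factorial_module M -> irreducibles M `&` generators M = set0 ->
  exists2 n : msharp M, irreducibles M (val n) & mdivides (val n) (val m).
Proof.
move=> [_ M_fact] irr_gen; have /set_mem[m_neq0 _] := valP m.
have [[qs [n [_ n_irr mE]]] _] := M_fact _ m_neq0.
(* The module factor [n] must have a class in D(M): it is nonzero because [m] is, and no irreducible
   element is a generator. *)
have n_sharp : msharp M n.
  split; first by apply: contra_neq m_neq0 => n0; rewrite mE n0 scaler0.
  by move=> n_gen; have : set0 n by rewrite -irr_gen.
by exists (SigSub (mem_set n_sharp)) => //=; exists (\prod_(q <- qs) q).
Qed.

Theorem theorem3 (R : idomainType) (M : lmodType R)
    (M_nonzero : exists m : M, m != 0)
    (M_nonsimple : ~ simple_module M)
    (M_factorial : factorial_module M)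
    (irr_gen_disjoint : irreducibles M `&` generators M = set0) :
  baire_space (divisor_space M).
Proof.
move=> F _ F_dense O [x Ox] O_open; have [m xE] := divisor_classE x.
have [n n_irr nm] :=
  factorial_irreducible_divisor _ _ m M_factorial irr_gen_disjoint.
(* This isolated point lies in [O] because [n] divides [m], and in each member of [F] by density. *)
exists (divisor_class n); split.
  by apply: open_divisor_closed O_open _ nm; rewrite -xE.
by move=> A /F_dense[_ A_dense]; apply: dense_irreducible.
Qed.
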